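(* Let $p$ be the peak value of the Collatz sequence starting at some positive integer $n$ (assumed to have a maximum), let $u$ be the odd number immediately before $p$ in this sequence, and let $v$ be the odd number immediately after $p$. Suppose $u=4^t k+\frac{4^t-1}{3}$ with a positive integer $t$ and $k=2l+1$ for a positive integer $l$. Then: (1) If $l$ is odd, then $2^{2t+1}\mid p$ and $v=3l+2$. (2) If $l$ is even, and $e$ is the nonnegative integer with $2^e\mid (3l+2)$ and $2^{e+1}\nmid (3l+2)$, then $2^{2t+e+1}\mid p$ and $v=\frac{3l+2}{2^e}$.
   Context: The Collatz map $T$ on the positive integers is $T(m)=m/2$ if $m$ is even and $T(m)=3m+1$ if $m$ is odd; $T^i$ denotes its $i$-fold iterate. The Collatz sequence starting at $n$ is the infinite sequence $n, T(n), T^2(n),\dots$. Its peak value is the maximum of all its terms. That $u$ is the odd number immediately before $p$ means that $u$ is odd and, for some $i\ge 0$, $T^i(n)=u$ and $T^{i+1}(n)=T(u)=p$. The odd number $v$ immediately after $p$ is the first odd term of the sequence $T(p),T^2(p),\dots$ (equivalently, the odd part of the even number $p$). *)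

(* Defs.v *)
From mathcomp Require Import all_boot.

Set Implicit Arguments.
Unset Strict Implicit.
Unset Printing Implicit Defensive.

(* The Collatz map is only meant on positive integers, which it preserves;
   the value at 0 (namely 0) is irrelevant. *)
Definition collatz (m : nat) : nat := if odd m then 3 * m + 1 else m %/ 2.

Definition collatz_seq (n i : nat) : nat := iter i collatz n.

Definition is_peak (n p : nat) : Prop :=
  (exists i, collatz_seq n i = p) /\ (forall i, collatz_seq n i <= p).

Definition odd_before (n u p : nat) : Prop :=
  odd u /\ exists i, collatz_seq n i = u /\ collatz_seq n i.+1 = p.

Definition odd_after (p v : nat) : Prop :=
  exists j, [/\ 0 < j, collatz_seq p j = v, odd v
    & forall i, 0 < i < j -> ~~ odd (collatz_seq p i)].

(* Main.v *)
Require Import Defs.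
From mathcomp Require Import all_boot.

Set Implicit Arguments.
Unset Strict Implicit.
Unset Printing Implicit Defensive.

(** Since [u] is odd, [p = 3 * u + 1]; the term [(4 ^ t - 1) / 3] of [u]
    contributes [4 ^ t - 1] to [3 * u], which the [+ 1] completes to [4 ^ t], so
    [p = 4 ^ t * (3 * k + 1) = 2 ^ (2 * t + 1) * (3 * l + 2)].
    From an even number the Collatz map only halves until it meets an odd term,
    so [v] is the odd part of [p] ([odd_after_pow2M]), that is, the odd part
    of [3 * l + 2]. For odd [l] this is [3 * l + 2] itself; for even [l] the
    remaining power of two is the [2 ^ e] of the statement. *)

Lemma collatz_seq_pow2M a i m :
  i <= a -> collatz_seq (2 ^ a * m) i = 2 ^ (a - i) * m.
Proof.
elim: i => [|i IHi] lt_ia; first by rewrite subn0.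
rewrite /collatz_seq iterS -/(collatz_seq _ i) IHi ?(ltnW lt_ia) //.
rewrite -(subnSK lt_ia) expnS -mulnA /collatz oddM /=.
by rewrite mulKn.
Qed.

(** The trajectory of [2 ^ a * m] reaches its first odd term after exactly [a]
    halvings; [0 < a] is needed because [odd_after] ignores the starting value
    itself, which is already odd when [a = 0]. *)
Lemma odd_after_pow2M a m v :
  0 < a -> odd m -> odd_after (2 ^ a * m) v -> v = m.
Proof.
move=> a_gt0 odd_m [j [_ <- odd_v even_before]].
case: (ltngtP j a) => [lt_ja | lt_aj | ->].
- move: odd_v; rewrite collatz_seq_pow2M ?(ltnW lt_ja) //.
  by rewrite -(subnSK lt_ja) expnS -mulnA oddM.
- have := even_before a; rewrite a_gt0 lt_aj collatz_seq_pow2M //.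
  by rewrite subnn mul1n odd_m => /(_ isT).
- by rewrite collatz_seq_pow2M // subnn mul1n.
Qed.

Lemma dvdn3_pow4_subn1 t : 3 %| 4 ^ t - 1.
Proof. by rewrite -eqn_mod_dvd ?expn_gt0 // -modnXm exp1n. Qed.

Lemma collatz_pow4_form t l u :
  odd u -> u = 4 ^ t * (2 * l + 1) + (4 ^ t - 1) %/ 3 ->
  collatz u = 2 ^ (2 * t + 1) * (3 * l + 2).
Proof.
move=> odd_u def_u; rewrite /collatz odd_u def_u mulnDr [3 * (_ %/ 3)]mulnC.
rewrite divnK ?dvdn3_pow4_subn1 // -addnA subnK ?expn_gt0 //.
rewrite mulnCA -mulnSr expnD expnM -mulnA; congr (_ * _).
by rewrite -[LHS]addn1 (mulnDr 3 (2 * l)) (mulnDr 2 (3 * l)) mulnCA -addnA.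
Qed.

(* Both quotients below are exact: 3 divides 4 ^ t - 1, and 2 ^ e divides
   3 * l + 2 by hypothesis. *)
Theorem theorem2p29 (n p u v t k l : nat) (hn : 0 < n)
    (hp : is_peak n p) (hu : odd_before n u p) (hv : odd_after p v)
    (ht : 0 < t) (hl : 0 < l) (hk : k = 2 * l + 1)
    (huk : u = 4 ^ t * k + (4 ^ t - 1) %/ 3) :
  (odd l -> 2 ^ (2 * t + 1) %| p /\ v = 3 * l + 2) /\
  (~~ odd l -> forall e : nat,
     2 ^ e %| 3 * l + 2 -> ~~ (2 ^ e.+1 %| 3 * l + 2) ->
     2 ^ (2 * t + e + 1) %| p /\ v = (3 * l + 2) %/ 2 ^ e).
Proof.
have [odd_u [i [seq_i seq_Si]]] := hu.
have def_p : p = 2 ^ (2 * t + 1) * (3 * l + 2).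
  rewrite -seq_Si /collatz_seq iterS -/(collatz_seq n i) seq_i.
  by apply: collatz_pow4_form; rewrite // -hk.
split=> [odd_l | _ e dvd_e ndvd_e].
  split; first by rewrite def_p dvdn_mulr.
  apply: (@odd_after_pow2M (2 * t + 1)); rewrite -?def_p ?addn1 //.
  by rewrite oddD oddM odd_l.
have def_p2 : p = 2 ^ (2 * t + e + 1) * ((3 * l + 2) %/ 2 ^ e).
  by rewrite addnAC expnD -mulnA [2 ^ e * _]mulnC divnK.
split; first by rewrite def_p2 dvdn_mulr.
apply: (@odd_after_pow2M (2 * t + e + 1)); rewrite -?def_p2 ?addn1 //.
(* An even cofactor would put one more factor 2 into [3 * l + 2]. *)
by move: ndvd_e; rewrite expnSr mulnC -dvdn_divRL // dvdn2 negbK.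
Qed.
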